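(* Let $e^{-K}\le\epsilon<1$, $c=\max\{\mathcal{C}_{\max},1\}$, where $\mathcal{C}_{\max}$ is the maximum element-wise curvature of $f(S)=\mathrm{Tr}(\mathbf{P}-\mathbf{F}_S^{-1})$, $s=\frac nK\log(1/\epsilon)$, $\beta=1+\max\left\{0,\frac{s}{2n}-\frac{1}{2(n-s)}\right\}$ and $$\alpha=1-e^{-\frac1c}-\frac{\epsilon^\beta}{c}.$$ Let $\mathrm{MSE}_{S_k}=\mathrm{Tr}(\mathbf{F}_{S_k}^{-1})$ be the mean-square estimation error obtained with the sensors $S_k$ selected by the randomized greedy algorithm with parameters $K$ and $\epsilon$, and let $\mathrm{MSE}_o=\mathrm{Tr}(\mathbf{F}_{O_k}^{-1})$ be the optimal mean-square error, where $O_k$ is an optimal solution of $\max_{S\subset[n],|S|=K}f(S)$. Then, the expectation being over the randomness of the algorithm, $$\mathbb{E}[\mathrm{MSE}_{S_k}]\le\alpha\,\mathrm{MSE}_o+(1-\alpha)\,\mathrm{Tr}(\mathbf{P}).$$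
   Context: Let $n\ge2$, $m\ge1$, $1\le K\le n$, $[n]=\{1,\dots,n\}$. At a fixed time step $k$, the following data are given and deterministic: a symmetric positive definite $\mathbf{P}\in\mathbb{R}^{m\times m}$ (the Kalman filter's predicted error covariance $\mathbf{P}_{k|k-1}$), measurement (column) vectors $\mathbf{h}_1,\dots,\mathbf{h}_n\in\mathbb{R}^m$, and noise variances $\sigma_1^2,\dots,\sigma_n^2>0$. For $S\subseteq[n]$, $$\mathbf{F}_S=\mathbf{P}^{-1}+\sum_{i\in S}\sigma_i^{-2}\mathbf{h}_i\mathbf{h}_i^\top,\qquad f(S)=\mathrm{Tr}(\mathbf{P}-\mathbf{F}_S^{-1}),\qquad f_i(S)=f(S\cup\{i\})-f(S).$$ The mean-square error of the filtered Kalman estimate using the sensors in $S$ is $\mathrm{MSE}_S=\mathrm{Tr}(\mathbf{F}_S^{-1})$. Element-wise curvature: for $1\le l\le n-1$, $$\mathcal{C}_l=\max_{(S,T,i)\in\mathcal{X}_l}\frac{f_i(T)}{f_i(S)},\qquad \mathcal{X}_l=\{(S,T,i): S\subset T\subset[n],\ i\in[n]\setminus T,\ |T\setminus S|=l\},$$ and $\mathcal{C}_{\max}=\max_{1\le l\le n-1}\mathcal{C}_l$. Convention: $0/0:=0$ (this occurs for the present $f$ only if $\mathbf{h}_i=\mathbf{0}$). Randomized greedy algorithm (parameters $K$ and $e^{-K}\le\epsilon<1$): let $s=\frac nK\log(1/\epsilon)$, assumed to be an integer. Start with $S_k^{(0)}=\emptyset$. For $i=0,\dots,K-1$: draw a set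 $R$ of $s$ distinct indices uniformly at random (without replacement, independently of the previous draws given $S_k^{(i)}$) from $[n]\setminus S_k^{(i)}$ (if fewer than $s$ indices remain, $R=[n]\setminus S_k^{(i)}$); choose $i_s\in\arg\max_{j\in R}f_j(S_k^{(i)})$; set $S_k^{(i+1)}=S_k^{(i)}\cup\{i_s\}$. Output $S_k=S_k^{(K)}$. When $s=n$, $\beta$ is interpreted as $1$. *)

(* Defs.v *)
From HB Require Import structures.
From mathcomp Require Import all_boot all_order all_algebra.
From mathcomp Require Import all_classical all_reals all_analysis.

Set Implicit Arguments.
Unset Strict Implicit.
Unset Printing Implicit Defensive.

Import Order.TTheory GRing.Theory Num.Theory.
Import numFieldNormedType.Exports.

Local Open Scope classical_set_scope.
Local Open Scope ring_scope.

Definition sym_posdef (R : realType) (m : nat) (P : 'M[R]_m) : Prop :=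
  P^T = P /\ forall x : 'cV[R]_m, x != 0 -> 0 < (x^T *m P *m x) 0 0.

Section Sensing.
Variables (R : realType) (n m : nat).
Variables (P : 'M[R]_m) (h : 'I_n -> 'cV[R]_m) (sigma : 'I_n -> R).

Definition info_mx (S : {set 'I_n}) : 'M[R]_m :=
  invmx P + \sum_(i in S) (sigma i) ^- 2 *: (h i *m (h i)^T).

Definition mse (S : {set 'I_n}) : R := \tr (invmx (info_mx S)).

Definition sensing_obj (S : {set 'I_n}) : R := \tr (P - invmx (info_mx S)).

End Sensing.

Section SetFunction.
Variables (R : realType) (n : nat) (f : {set 'I_n} -> R).

Definition marginal (i : 'I_n) (S : {set 'I_n}) : R :=
  f (S :|: [set i])%SET - f S.

(* The maximum of a nonempty finite sequence; folding from its head avoids an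
   artificial lower bound on the result. *)
Definition seq_max (r : seq R) : R := \big[Num.max/head 0 r]_(x <- r) x.

Definition curvature_triples (l : nat) :
    {set {set 'I_n} * {set 'I_n} * 'I_n} :=
  [set x : {set 'I_n} * {set 'I_n} * 'I_n |
    [&& x.1.1 \subset x.1.2, x.2 \notin x.1.2
      & #|(x.1.2 :\: x.1.1)%SET| == l]]%SET.

(* [_ / 0 = 0] in a field, which is the convention 0/0 := 0. *)
Definition curvature (l : nat) : R :=
  seq_max [seq marginal x.2 x.1.2 / marginal x.2 x.1.1
          | x in curvature_triples l].

Definition max_curvature : R :=
  seq_max [seq curvature l | l <- index_iota 1 n].

Definition is_optimal (K : nat) (O : {set 'I_n}) : Prop :=
  #|O| = K /\ forall S : {set 'I_n}, #|S| = K -> f S <= f O.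

(* Probability of drawing [A] when sampling [s] distinct elements uniformly
   from the complement of [B] (all of it if it has fewer than [s] elements). *)
Definition draw_prob (s : nat) (B A : {set 'I_n}) : R :=
  let N := #|(~: B)%SET| in
  if (A \subset (~: B)%SET) && (#|A| == minn s N)
  then ('C(N, minn s N)%:R)^-1 else 0.

(* [S i] is the set selected after [i] iterations, [D i] the sample drawn in
   iteration [i].  The tie-breaking in the argmax is left arbitrary: it may
   depend on the whole history and be randomized.  [rg_draw] says that, given
   [S i], the sample is uniform and independent of the previous samples. *)
Record randomized_greedy (d : measure_display) (Omega : measurableType d)
    (Pr : probability Omega R) (K s : nat)
    (S D : nat -> Omega -> {set 'I_n}) : Prop := {
  rg_measS : forall i A, (i <= K)%N -> measurable [set w | S i w = A];
  rg_measD : forall i A, (i < K)%N -> measurable [set w | D i w = A];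
  rg_init : forall w, S 0%N w = finset.set0;
  rg_draw : forall i (A B : {set 'I_n}) (rho : nat -> {set 'I_n}),
    (i < K)%N ->
    let H := [set w | S i w = B /\ forall j, (j < i)%N -> D j w = rho j] in
    Pr (H `&` [set w | D i w = A]) = ((draw_prob s B A)%:E * Pr H)%E;
  rg_step : forall i w, (i < K)%N ->
    exists j : 'I_n, [/\ j \in D i w,
      forall j' : 'I_n, j' \in D i w ->
        marginal j' (S i w) <= marginal j (S i w)
      & S i.+1 w = (S i w :|: [set j])%SET] }.

End SetFunction.

(* Read as 1 when [s = n]: 1/(2(n-s)) is then infinite, so that the maximum
   is 0, whereas [1 / 0] is 0 in a field. *)
Definition greedy_beta (R : realType) (n s : nat) : R :=
  if s == n then 1
  else 1 + Num.max 0 (s%:R / (2 * n%:R) - 1 / (2 * (n%:R - s%:R))).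

Definition greedy_alpha (R : realType) (n s : nat) (c eps : R) : R :=
  1 - expR (- (1 / c)) - (eps `^ greedy_beta R n s) / c.

(* Main.v *)
(** One iteration at the current set [B] gains at least the average of the
    marginals [f_j(B)] over the drawn part of [O \ B].  By symmetry of the draw,
    its mean is the probability that the draw meets [O \ B] times the average of
    [f_j(B)] over [O \ B].  That probability is at least [(1 - eps^beta) k / K],
    [k = |O \ B|], because [\sum_(l < s) 1 / (n - l) >= beta s / n], and adding
    the elements of [O \ B] one at a time shows that [c] times the sum of
    [f_j(B)] over [O \ B] dominates [f O - f B].  Hence each iteration contracts
    the expected gap to [f O] by [1 - (1 - eps^beta) / (K c)].  The curvature
    ratios are meaningful because, by Sherman-Morrison, [f_i(S)] vanishes for
    [i] outside [S] only if [h i = 0]. *)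

Require Import Defs.
From HB Require Import structures.
From mathcomp Require Import all_boot all_order all_algebra.
From mathcomp Require Import all_classical all_reals all_analysis.
From mathcomp Require Import perm ring lra.

Set Implicit Arguments.
Unset Strict Implicit.
Unset Printing Implicit Defensive.

Import Order.TTheory GRing.Theory Num.Theory.
Import numFieldNormedType.Exports.

Local Open Scope classical_set_scope.
Local Open Scope ring_scope.

(** * Squared norms of column vectors *)

Section TrmxMul.
Context {R : realType} {m : nat}.
Implicit Types h : 'cV[R]_m.

Lemma trmx_mul_ge0 h : 0 <= (h^T *m h) 0 0.
Proof. by rewrite mxE sumr_ge0// => i _; rewrite mxE -expr2 sqr_ge0. Qed.

Lemma trmx_mul_eq0 h : (h^T *m h) 0 0 = 0 -> h = 0.
Proof.
rewrite mxE => /psumr_eq0P h0; apply/colP => i; rewrite mxE.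
have := h0 _ i isT; rewrite mxE => h1; apply/eqP; rewrite -sqrf_eq0 expr2 h1// => j _.
by rewrite mxE -expr2 sqr_ge0.
Qed.
End TrmxMul.

(** * Symmetric positive definite matrices and rank-one updates *)

Section PositiveDefinite.
Context {R : realType} {m : nat}.
Implicit Types (A : 'M[R]_m) (h x : 'cV[R]_m).

(** A nonzero row of the kernel matrix, transposed, would be a vector on which the quadratic form
    vanishes. *)
Lemma sym_posdef_unit A : sym_posdef A -> A \in unitmx.
Proof.
move=> [_ Apos]; rewrite -row_free_unit -kermx_eq0.
apply/eqP/row_matrixP => i; rewrite row0; apply/eqP; rewrite -trmx_eq0.
apply/negPn/negP => /Apos; rewrite trmxK.
have /sub_kermxP -> : (row i (kermx A) <= kermx A)%MS by exact: row_sub.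
by rewrite mul0mx mxE ltxx.
Qed.

Lemma trmx_invmx_sym A : sym_posdef A -> (invmx A)^T = invmx A.
Proof. by move=> [AT _]; rewrite trmx_inv AT. Qed.

Lemma sym_posdef_inv A : sym_posdef A -> sym_posdef (invmx A).
Proof.
move=> Apd; have [_ Apos] := Apd; have Au := sym_posdef_unit Apd.
split=> [|x x0]; first exact: trmx_invmx_sym.
have := Apos (invmx A *m x); rewrite trmx_mul trmx_invmx_sym// !mulmxA mulmxKV//.
apply; apply: contra_neq x0 => Ax0; by rewrite -[x](mulKVmx Au) Ax0 mulmx0.
Qed.

Lemma sym_posdef_rank1 A h (w : R) : 0 <= w -> sym_posdef A ->
  sym_posdef (A + w *: (h *m h^T)).
Proof.
move=> w0 [AT Apos]; split; first by rewrite linearD/= linearZ/= trmx_mul trmxK AT.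
move=> x x0; rewrite mulmxDr mulmxDl mxE ltr_pwDl ?Apos//.
rewrite -scalemxAr -scalemxAl mxE mulr_ge0//.
have -> : x^T *m (h *m h^T) *m x = (h^T *m x)^T *m (h^T *m x).
  by rewrite trmx_mul trmxK !mulmxA.
exact: trmx_mul_ge0.
Qed.

(** Trace form of Sherman-Morrison: with [q = h^T u], [B *m u = (1 + w * q) *: h] yields
    [invmx B *m h], which is substituted into [A^-1 - B^-1 = B^-1 (B - A) A^-1]. *)
Lemma mxtrace_invmx_rank1 A h (w : R) : 0 <= w -> sym_posdef A ->
  let u := invmx A *m h in
  0 < 1 + w * (h^T *m u) 0 0 /\
  \tr (invmx A) - \tr (invmx (A + w *: (h *m h^T))) =
    w * (u^T *m u) 0 0 / (1 + w * (h^T *m u) 0 0).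
Proof.
move=> w0 Apd u; set B := A + _.
have Au := sym_posdef_unit Apd.
have Bu : B \in unitmx by apply: sym_posdef_unit; exact: sym_posdef_rank1.
set q := (h^T *m u) 0 0.
have q0 : 0 <= q.
  have -> : q = (u^T *m A *m u) 0 0.
    by rewrite /q /u trmx_mul trmx_invmx_sym// mulmxKV.
  have [->|/(proj2 Apd)/ltW//] := eqVneq u 0; by rewrite mulmx0 mxE.
have k0 : 0 < 1 + w * q by rewrite ltr_pwDl ?mulr_ge0.
split=> //.
have Binv : invmx B *m h = (1 + w * q)^-1 *: u.
  have Bu' : B *m u = (1 + w * q) *: h.
    rewrite /B mulmxDl /u mulKVmx// -/u -scalemxAl -mulmxA (mx11_scalar (h^T *m u)).
    by rewrite mul_mx_scalar scalerA scalerDl scale1r.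
  have -> : h = (1 + w * q)^-1 *: (B *m u) by rewrite Bu' scalerA mulVf ?scale1r ?gt_eqF.
  by rewrite -scalemxAr mulKmx.
have -> : \tr (invmx A) - \tr (invmx B) = \tr (invmx B *m (B - A) *m invmx A).
  by rewrite mulmxBr mulVmx// mulmxBl mul1mx mulmxK// linearB.
rewrite {2}/B addrC addKr -scalemxAr -scalemxAl mulmxA Binv linearZ/=.
rewrite -!scalemxAl linearZ/= -mulmxA mxtrace_mulC /mxtrace big_ord1 -mulrA.
rewrite /u trmx_mul trmx_invmx_sym//.
ring.
Qed.
End PositiveDefinite.

(** * Marginals of the sensing objective *)

Section SensingObjective.
Context {R : realType} {n m : nat}.
Variables (P : 'M[R]_m) (h : 'I_n -> 'cV[R]_m) (sigma : 'I_n -> R).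
Hypothesis Ppd : sym_posdef P.
Hypothesis sigma_gt0 : forall i, 0 < sigma i ^+ 2.
Implicit Types (S T : {set 'I_n}) (i : 'I_n).
Local Notation F := (info_mx P h sigma).
Local Notation f := (sensing_obj P h sigma).

Lemma info_mxU1 S i : i \notin S ->
  F (S :|: [set i])%SET = F S + (sigma i) ^- 2 *: (h i *m (h i)^T).
Proof. by move=> iS; rewrite /info_mx finset.setUC big_setU1//= [X in _ + X]addrC addrA. Qed.

Lemma info_mx_posdef S : sym_posdef (F S).
Proof.
rewrite /info_mx; elim/big_rec: _ => [|i X _ IH].
  by rewrite addr0; exact: sym_posdef_inv.
by rewrite addrCA addrC; apply: sym_posdef_rank1 => //; rewrite invr_ge0 ltW.
Qed.

Lemma sensing_objE S : f S = \tr P - mse P h sigma S.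
Proof. exact: linearB. Qed.

Lemma sensing_obj0 : f finset.set0 = 0.
Proof. by rewrite /sensing_obj /info_mx big_set0 addr0 invmxK subrr linear0. Qed.

Lemma sensing_marginalE S i : i \notin S ->
  let u := invmx (F S) *m h i in
  0 < 1 + (sigma i) ^- 2 * ((h i)^T *m u) 0 0 /\
  marginal f i S =
  (sigma i) ^- 2 * (u^T *m u) 0 0 / (1 + (sigma i) ^- 2 * ((h i)^T *m u) 0 0).
Proof.
move=> iS u.
have w0 : 0 <= (sigma i) ^- 2 by rewrite invr_ge0 ltW.
have [k0 E] := mxtrace_invmx_rank1 (h i) w0 (info_mx_posdef S).
split=> //; rewrite -E /marginal !sensing_objE /mse info_mxU1//; ring.
Qed.

Lemma sensing_marginal_ge0 i S : 0 <= marginal f i S.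
Proof.
have [iS|iS] := boolP (i \in S).
  have SiS : (S :|: [set i] = S)%SET by apply/finset.setUidPl; rewrite finset.sub1set.
  by rewrite /marginal SiS subrr.
have [k0 ->] := sensing_marginalE iS.
by rewrite divr_ge0 ?(ltW k0)// mulr_ge0 ?trmx_mul_ge0// invr_ge0 ltW.
Qed.

(** The numerator is a positive multiple of the squared norm of [invmx (F S) *m h i]; its vanishing
    forces [h i = 0], a condition independent of the set. *)
Lemma sensing_marginal_eq0 i S T : i \notin S -> i \notin T ->
  marginal f i S = 0 -> marginal f i T = 0.
Proof.
move=> iS iT; have [k0 ->] := sensing_marginalE iS.
move/eqP; rewrite mulf_eq0 invr_eq0 (gt_eqF k0) orbF mulf_eq0 invr_eq0 gt_eqF//= => /eqP/trmx_mul_eq0 hi0.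
have {}hi0 : h i = 0 by rewrite -[h i](mulKVmx (sym_posdef_unit (info_mx_posdef S))) hi0 mulmx0.
have [_ ->] := sensing_marginalE iT; by rewrite hi0 !mulmx0 mxE mulr0 mul0r.
Qed.
End SensingObjective.

(** * Scalar bounds on the probability of missing marked elements *)

Section HitProbability.
Context {R : realType}.

(** The ratio of the binomials is the product over [l < t] of [1 - k / (N - l)], truncated at 0; as
    [N <= n], each factor is at most [expR (- k / (n - l))]. The induction peels off the last
    factor. *)
Lemma bin_le_expR (n N k t : nat) : (t <= N <= n)%N ->
  'C(N - k, t)%:R <= 'C(N, t)%:R * expR (- (k%:R * \sum_(l < t) (n%:R - l%:R)^-1)) :> R.
Proof.
elim: t => [_|t IH /andP[tN Nn]]; first by rewrite !bin0 big_ord0 mulr0 oppr0 expR0 mulr1.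
have {}IH := IH _; rewrite ltnW//= in IH; have {IH} := IH Nn.
set E := expR _ => IH.
have Nt : 0 < N%:R - t%:R :> R by rewrite subr_gt0 ltr_nat.
have nt : 0 < n%:R - t%:R :> R by rewrite subr_gt0 ltr_nat (leq_trans tN).
have /(congr1 (GRing.natmul (1 : R))) := mul_bin_left N t.
have /(congr1 (GRing.natmul (1 : R))) := mul_bin_left (N - k) t.
rewrite !natrM [in X in _ -> X](natrB _ (ltnW tN)) => H1 H2.
rewrite -(ler_pM2l (ltr0Sn R t)) H1 mulrA H2.
rewrite big_ord_recr/= mulrDr opprD expRD -/E.
set e := expR (- (k%:R / _)).
have He : (N - k - t)%:R <= (N%:R - t%:R) * e.
  have [kNt|/ltnW] := leqP (N - t) k.
    have -> : (N - k - t = 0)%N by apply/eqP; rewrite subnAC subn_eq0.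
    by rewrite mulr_ge0 ?expR_ge0// ltW.
  move=> kNt; rewrite -subnDA addnC subnDA natrB// natrB ?(ltnW tN)//.
  apply: (@le_trans _ _ ((N%:R - t%:R) * (1 - k%:R / (n%:R - t%:R)))); last first.
    by rewrite ler_pM2l// expR_ge1Dx.
  rewrite mulrBr mulr1 lerD2l lerN2 mulrCA ler_piMr//.
  by rewrite ler_pdivrMr// mul1r lerB// ler_nat.
rewrite (_ : _ * (E * e) = ((N%:R - t%:R) * e) * ('C(N, t)%:R * E)); last by ring.
by apply: ler_pM.
Qed.

(** The bound [1 / (n - l) >= 1 / n] settles the cases where beta is 1. Otherwise
    [1 / (n - l) >= 1 / n + l / n^2] sums to [(1 + s / (2 n) - 1 / (2 n)) * (s / n)], and
    [1 / (2 n) <= 1 / (2 (n - s))]. *)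
Lemma sum_inv_ge_beta (n s : nat) : (s <= n)%N ->
  greedy_beta R n s * (s%:R / n%:R) <= \sum_(l < s) (n%:R - l%:R)^-1.
Proof.
move=> sn; have [->|s0] := posnP s; first by rewrite mul0r mulr0 big_ord0.
have n0 : 0 < n%:R :> R by rewrite ltr0n (leq_trans s0).
have h1 : s%:R / n%:R <= \sum_(l < s) (n%:R - l%:R)^-1 :> R.
  rewrite mulr_natl -[in leLHS](card_ord s) -sumr_const ler_sum// => l _.
  have ln : 0 < n%:R - l%:R :> R by rewrite subr_gt0 ltr_nat (leq_trans (ltn_ord l)).
  by rewrite lef_pV2 ?posrE// lerBlDr lerDl.
rewrite /greedy_beta; case: eqP => [_|/eqP sneq]; first by rewrite mul1r.
have {sneq} sn' : (s < n)%N by rewrite ltn_neqAle sneq.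
rewrite mulrDl div1r mul1r; case: (leP 0 (_ - _)) => b0; last by rewrite mul0r addr0.
have ns : 0 < n%:R - s%:R :> R by rewrite subr_gt0 ltr_nat.
have h2 : \sum_(l < s) (n%:R^-1 + l%:R / n%:R ^+ 2) <= \sum_(l < s) (n%:R - l%:R)^-1 :> R.
  rewrite ler_sum// => l _.
  have ln : 0 < n%:R - l%:R :> R by rewrite subr_gt0 ltr_nat (leq_trans (ltn_ord l)).
  rewrite -[leRHS]mul1r ler_pdivlMr// -[leRHS](mulfV (lt0r_neq0 n0)).
  have -> : (n%:R^-1 + l%:R / n%:R ^+ 2) * (n%:R - l%:R) = 1 - (l%:R / n%:R) ^+ 2 :> R.
    by field; rewrite gt_eqF.
  by rewrite mulfV ?gt_eqF// gerBl sqr_ge0.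
have hsum : \sum_(l < s) (l%:R : R) = s%:R * (s%:R - 1) / 2.
  elim: {+}s => [|p IH]; first by rewrite big_ord0 !mul0r.
  by rewrite big_ord_recr/= IH -natr1; field.
apply: le_trans h2; rewrite big_split/= sumr_const card_ord -[n%:R^-1 *+ s]mulr_natl -mulr_suml hsum.
have : (2 * n%:R)^-1 <= (2 * (n%:R - s%:R))^-1 :> R.
  by rewrite lef_pV2 ?posrE ?mulr_gt0// ler_pM2l// gerBl.
move=> h3.
have -> : s%:R * (s%:R - 1) / 2 / n%:R ^+ 2 = (s%:R / (2 * n%:R) - (2 * n%:R)^-1) * (s%:R / n%:R) :> R.
  by field; rewrite gt_eqF.
by rewrite lerD2l ler_wpM2r ?divr_ge0// lerB.
Qed.

(** By convexity of the exponential, the graph of [t |-> y^t] lies below its chord from [t = 0] to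
    [t = 1]. *)
Lemma powR_chord (y t : R) : 0 < y -> 0 <= t <= 1 -> y `^ t <= 1 - (1 - y) * t.
Proof.
move=> y0 /andP[t0 t1].
have := @convex_expR R (Itv01 t0 t1) (ln y) 0.
rewrite !convRE/= expR0 lnK ?posrE// mulr0 addr0 mulr1 /powR gt_eqF// => /le_trans.
apply; rewrite /unstable.onem; lra.
Qed.
End HitProbability.

(** * Averages over a uniform draw without replacement *)

Section Draw.
Context {R : realType} {n : nat}.
Variables (s : nat) (B W : {set 'I_n}).
Hypothesis WB : W \subset (~: B)%SET.

Lemma draw_prob_imset (g : 'I_n -> 'I_n) (A : {set 'I_n}) : injective g ->
  (forall x, (g x \in (~: B)%SET) = (x \in (~: B)%SET)) ->
  draw_prob R s B (g @: A)%SET = draw_prob R s B A.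
Proof.
move=> g_inj gB; rewrite /draw_prob card_imset//.
congr (if _ && _ then _ else _).
apply/fintype.subsetP/fintype.subsetP => [AB x xA|AB _ /imsetP[x xA ->]].
  by rewrite -gB AB// imset_f.
by rewrite gB AB.
Qed.

(** The samples avoiding [V] are the subsets of the complement of [B], minus [V], of the prescribed
    size. Taking [V] empty gives total mass 1. *)
Lemma draw_prob_sum_disjoint (V : {set 'I_n}) : V \subset (~: B)%SET ->
  let N := #|(~: B)%SET| in
  \sum_(A : {set 'I_n} | (A :&: V)%SET == finset.set0) draw_prob R s B A =
  'C(N - #|V|, minn s N)%:R / 'C(N, minn s N)%:R.
Proof.
move=> VB N; rewrite (bigID [pred A : {set 'I_n} | (A \subset (~: B)%SET) && (#|A| == minn s N)])/=.
rewrite [X in _ + X]big1 ?addr0; last first.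
  by move=> A /andP[_ /negbTE h]; rewrite /draw_prob h.
rewrite (eq_bigr (fun=> ('C(N, minn s N)%:R)^-1)); last first.
  by move=> A /andP[_ h]; rewrite /draw_prob h.
rewrite sumr_const -[LHS]mulr_natl; congr (_%:R / _).
rewrite -[in RHS](finset.setIidPr VB) -cardsD -cards_draws.
apply: eq_card => A; rewrite unfold_in finset.inE subsetD finset.setI_eq0.
by case: (A \subset _); rewrite ?andbT ?andbF//= andbC.
Qed.

Lemma draw_prob_sum1 : \sum_(A : {set 'I_n}) draw_prob R s B A = 1.
Proof.
have := draw_prob_sum_disjoint (finset.sub0set (~: B)%SET).
rewrite /= !cards0 subn0 divff ?pnatr_eq0 -?lt0n ?bin_gt0 ?geq_minr// => <-.
by apply: eq_bigl => A; rewrite finset.setI0 eqxx.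
Qed.

(** For [j] in [W], the probability that [j] is the outcome of drawing [A] and then a uniform
    element of [A :&: W]. *)
Let q (j : 'I_n) : R :=
  \sum_(A : {set 'I_n}) draw_prob R s B A * ((j \in A)%:R / #|(A :&: W)%SET|%:R).

(** The transposition of [i] and [j] preserves both [W] and the complement of [B], so the sum can be
    reindexed along it. *)
Let q_const (i j : 'I_n) : i \in W -> j \in W -> q i = q j.
Proof.
move=> iW jW; rewrite /q.
have tW x : (tperm i j x \in W) = (x \in W).
  by case: tpermP => [->|->|//]; rewrite iW jW.
have tB x : (tperm i j x \in (~: B)%SET) = (x \in (~: B)%SET).
  by case: tpermP => [->|->|//]; rewrite !(fintype.subsetP WB).
rewrite [RHS](reindex_inj (imset_inj (@perm_inj _ (tperm i j)))).
apply: eq_bigr => A _; rewrite (draw_prob_imset _ perm_inj tB).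
congr (_ * (_%:R / _%:R)); first by rewrite -{1}(tpermL i j) mem_imset//; exact: perm_inj.
rewrite -(card_imset _ (@perm_inj _ (tperm i j))); apply: eq_card => x.
apply/imsetP/idP => [[y /finset.setIP[yA yW] ->]|/finset.setIP[/imsetP[y yA ->] yW]].
  by rewrite inE imset_f//= tW.
by exists y => //; rewrite inE yA -tW.
Qed.

(* A uniform element of [A :&: W], given that this set is nonempty, is uniform
   in [W] because the law of [A] is invariant under permutations of [W]; the
   average over an empty [A :&: W] is [0 / 0 = 0]. *)
Lemma draw_average (v : 'I_n -> R) : W != finset.set0 ->
  let N := #|(~: B)%SET| in
  \sum_(A : {set 'I_n}) draw_prob R s B A *
      ((\sum_(j in (A :&: W)%SET) v j) / #|(A :&: W)%SET|%:R) =
  (1 - 'C(N - #|W|, minn s N)%:R / 'C(N, minn s N)%:R) / #|W|%:R * \sum_(j in W) v j.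
Proof.
move=> W0 N; have [j0 j0W] := finset.set0Pn _ W0.
have W0R : #|W|%:R != 0 :> R by rewrite pnatr_eq0 cards_eq0.
(* Summing [q] over [W] gives the probability that the draw meets [W], and all [#|W|] terms are
   equal. *)
have -> : 1 - 'C(N - #|W|, minn s N)%:R / 'C(N, minn s N)%:R = #|W|%:R * q j0.
  rewrite /N -(draw_prob_sum_disjoint WB) -[X in X - _]draw_prob_sum1.
  rewrite (bigID (fun A : {set 'I_n} => (A :&: W == finset.set0)%SET))/= addrC addrK.
  rewrite [RHS]mulr_natl -sumr_const (eq_bigr q); last by move=> j; exact: q_const.
  rewrite exchange_big/=.
  rewrite big_mkcond/=; apply: eq_bigr => A _.
  rewrite -mulr_sumr -mulr_suml -natr_sum.
  have -> : (\sum_(j in W) (j \in A) = #|(A :&: W)%SET|)%N.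
    rewrite -sum1_card big_mkcond [RHS]big_mkcond/=; apply: eq_bigr => j _.
    by rewrite inE; case: (j \in A); case: (j \in W).
  have [->|A0] := eqVneq; first by rewrite cards0 mul0r mulr0.
  by rewrite divff ?mulr1// pnatr_eq0 cards_eq0.
rewrite [X in X * _]mulrAC divff// mul1r mulr_sumr.
rewrite [RHS](eq_bigr (fun j => q j * v j)); last by move=> j jW; rewrite (q_const jW j0W).
under [RHS]eq_bigr do rewrite mulr_suml.
rewrite exchange_big/=; apply: eq_bigr => A _.
rewrite mulr_suml mulr_sumr big_mkcond [RHS]big_mkcond/=; apply: eq_bigr => j _.
rewrite inE; case: (j \in A); case: (j \in W) => //=; last by rewrite mul0r mulr0 mul0r.
by rewrite div1r -mulrA [v j * _]mulrC.
Qed.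
End Draw.

(** * Expected gain of one draw in terms of epsilon and K *)

Section GreedyStep.
Context {R : realType} {n : nat}.
Variables (s K : nat) (eps : R).
Hypotheses (K0 : (0 < K)%N) (sn : (s <= n)%N) (eps0 : 0 < eps).
Hypothesis sE : s%:R = n%:R / K%:R * ln (1 / eps).
Local Notation y := (eps `^ greedy_beta R n s).

Lemma hit_prob_ge (N k : nat) : (0 < k <= K)%N -> (k <= N <= n)%N ->
  (1 - y) * (k%:R / K%:R) <= 1 - 'C(N - k, minn s N)%:R / 'C(N, minn s N)%:R.
Proof.
move=> /andP[k0 kK] /andP[kN Nn].
have KR : 0 < K%:R :> R by rewrite ltr0n.
have nR : 0 < n%:R :> R by rewrite ltr0n (leq_trans k0)// (leq_trans kN).
have t01 : 0 <= (k%:R / K%:R : R) <= 1 by rewrite divr_ge0//= ler_pdivrMr// mul1r ler_nat.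
have y0 : 0 < y by rewrite powR_gt0.
(* If at most [s] elements remain, all of them are drawn, so the miss probability is 0. *)
have [sN|/ltnW Ns] := leqP s N; last first.
  rewrite [in 'C(_ - _, _)]bin_small ?mul0r ?subr0; last by rewrite ltn_subrL k0 (leq_trans k0).
  by have /andP[t0] := t01; apply: le_trans; rewrite ler_piMl// gerBl ltW.
have CN : 0 < 'C(N, s)%:R :> R by rewrite ltr0n bin_gt0.
have : y `^ (k%:R / K%:R) <= 1 - (1 - y) * (k%:R / K%:R) by exact: powR_chord.
rewrite lerBrDl -lerBrDr => /le_trans; apply.
rewrite lerB// ler_pdivrMr// mulrC.
have := @bin_le_expR R n N k s; rewrite sN Nn => /(_ isT) /le_trans; apply.
rewrite ler_pM2l// -powRrM {1}/powR gt_eqF// ler_expR.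
have -> : ln eps = - (K%:R * (s%:R / n%:R)).
  rewrite sE div1r lnV ?posrE//; field; rewrite !gt_eqF//.
rewrite mulrN lerN2 (_ : _ * (K%:R * _) = k%:R * (greedy_beta R n s * (s%:R / n%:R))); last first.
  by field; rewrite !gt_eqF.
by rewrite ler_wpM2l// sum_inv_ge_beta.
Qed.

(** The factor [#|W|] in the hit probability cancels the [#|W|] dividing the sum in the average over
    [W]. *)
Lemma draw_average_ge (B W : {set 'I_n}) (v : 'I_n -> R) :
  W \subset (~: B)%SET -> (#|W| <= K)%N -> (forall j, 0 <= v j) ->
  (1 - y) / K%:R * \sum_(j in W) v j <=
  \sum_(A : {set 'I_n}) draw_prob R s B A *
      ((\sum_(j in (A :&: W)%SET) v j) / #|(A :&: W)%SET|%:R).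
Proof.
move=> WB WK v0; have [->|W0] := eqVneq W finset.set0.
  rewrite big_set0 mulr0 sumr_ge0// => A _.
  by rewrite finset.setI0 big_set0 mul0r mulr0.
rewrite draw_average// ler_wpM2r ?sumr_ge0//.
have W1 : (0 < #|W|)%N by rewrite lt0n cards_eq0.
have WR : 0 < #|W|%:R :> R by rewrite ltr0n.
rewrite ler_pdivlMr// mulrAC -mulrA hit_prob_ge ?W1//.
by rewrite subset_leq_card//= -[leqRHS]card_ord max_card.
Qed.
End GreedyStep.

(** * Curvature bounds for monotone set functions *)

Section Curvature.
Context {R : realType} {n : nat}.
Variable f : {set 'I_n} -> R.
Implicit Types (S T B W O : {set 'I_n}).
Hypothesis marginal_ge0 : forall i S, 0 <= marginal f i S.
Hypothesis marginal_eq0 : forall i S T, i \notin S -> i \notin T ->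
  marginal f i S = 0 -> marginal f i T = 0.
Local Notation c := (Num.max (max_curvature f) 1).

Lemma le_seq_max (r : seq R) x : x \in r -> x <= seq_max r.
Proof. by move=> xr; exact: (@le_bigmax_seq _ _ _ r _ x xpredT id). Qed.

(** Curvatures start at [l = 1], so [S = T] relies on [1 <= c]. A zero marginal at [S] makes the
    ratio uninformative, but then the marginal at [T] is zero too. Otherwise the ratio is one of
    those maximised, with [l < n] because [i] is outside [T]. *)
Lemma marginal_le_curvature i S T : S \subset T -> i \notin T ->
  marginal f i T <= c * marginal f i S.
Proof.
move=> ST iT; have iS : i \notin S by apply: contra iT; apply: (fintype.subsetP ST).
have [TS|TS] := eqVneq (#|(T :\: S)%SET|) 0%N.
  have -> : T = S.
    by apply/eqP; rewrite finset.eqEsubset ST andbT -finset.setD_eq0 -cards_eq0 TS.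
  by rewrite ler_peMl// le_max lexx orbT.
have [S0|S0] := eqVneq (marginal f i S) 0.
  by rewrite (marginal_eq0 iS iT S0) S0 mulr0.
have Spos : 0 < marginal f i S by rewrite lt_neqAle eq_sym S0 marginal_ge0.
rewrite -ler_pdivrMr// le_max; apply/orP; left.
apply: (@le_trans _ _ (curvature f #|(T :\: S)%SET|)).
  apply: le_seq_max; apply/fintype.imageP; exists (S, T, i) => //.
  by rewrite finset.inE/= ST iT eqxx.
apply: le_seq_max; apply: map_f; rewrite mem_index_iota lt0n TS/=.
rewrite -[ltnRHS](card_ord n) -cardsT; apply: proper_card; apply/properP; split; first exact: finset.subsetT.
by exists i => //; rewrite finset.inE (negbTE iT) andbF.
Qed.

(** Telescoping over the elements of [W], each increment being compared with the marginal at [B].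
    The lower bound records that [f] is monotone. *)
Lemma setU_marginal_sum B W : W \subset (~: B)%SET ->
  0 <= f (B :|: W)%SET - f B <= c * \sum_(j in W) marginal f j B.
Proof.
have [k] := ubnP #|W|; elim: k W => // k IH W Wk WB.
have [->|/finset.set0Pn[j jW]] := eqVneq W finset.set0.
  by rewrite finset.setU0 subrr big_set0 mulr0 lexx.
have WjB : (W :\ j)%SET \subset (~: B)%SET.
  by apply: fintype.subset_trans WB; exact: finset.subD1set.
have /IH/(_ WjB) /andP[IH0 IH1] : (#|(W :\ j)%SET| < k)%N by move: Wk; rewrite (cardsD1 j W) jW.
have jB : j \notin B by move: (fintype.subsetP WB j jW); rewrite finset.inE.
have E : f (B :|: W)%SET - f B = marginal f j (B :|: W :\ j)%SET + (f (B :|: W :\ j)%SET - f B).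
  by rewrite /marginal -finset.setUA [(W :\ j :|: _)%SET]finset.setUC finset.setD1K// addrA subrK.
rewrite E addr_ge0//= (finset.big_setD1 j)//= mulrDr lerD// marginal_le_curvature//.
  exact: finset.subsetUl.
by rewrite !finset.inE eqxx (negbTE jB).
Qed.

(** Monotonicity replaces [f O] by the value at [O :|: B], which is reached from [B] by adding
    [O :\: B]. *)
Lemma optimum_gap B O : f O - f B <= c * \sum_(j in (O :\: B)%SET) marginal f j B.
Proof.
have OB : (O :\: B)%SET \subset (~: B)%SET by rewrite finset.setDE finset.subsetIr.
have /andP[_] := setU_marginal_sum OB; apply: le_trans; rewrite lerB//.
have BO : (B :\: O)%SET \subset (~: O)%SET by rewrite finset.setDE finset.subsetIr.
have /andP[+ _] := setU_marginal_sum BO; rewrite subr_ge0.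
suff -> : (O :|: B :\: O = B :|: O :\: B)%SET by [].
by apply/setP => x; rewrite !finset.inE; case: (x \in O); case: (x \in B).
Qed.
End Curvature.

(** * Expectations of functions of a finite-valued random variable *)

Section FiniteExpectation.
Context {R : realType} {d : measure_display} {Omega : measurableType d}.
Variable Pr : probability Omega R.
Context {T : finType} (X : Omega -> T).
Hypothesis mX : forall x, measurable [set w | X w = x].

Let finE (G : T -> R) (w : Omega) :
  (G (X w))%:E = (\sum_x (G x)%:E * (\1_[set w | X w = x] w)%:E)%E.
Proof.
rewrite (bigD1 (X w))//= big1 ?adde0; last first.
  by move=> x xX; rewrite indicE memNset ?mule0//= => E; rewrite E eqxx in xX.
by rewrite indicE mem_set// mule1.
Qed.

Lemma integrable_finite_range (G : T -> R) : Pr.-integrable setT (fun w => (G (X w))%:E).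
Proof.
rewrite (_ : (fun w => _) = (fun w => \sum_x (G x)%:E * (\1_[set w | X w = x] w)%:E)%E).
  by apply: integrable_sum => // x _; apply: integrableZl => //; exact: integrable_indic.
by apply/funext => w; exact: finE.
Qed.

Lemma integral_finite_range (G : T -> R) :
  (\int[Pr]_w (G (X w))%:E = (\sum_x G x * fine (Pr [set w | X w = x]))%:E)%E.
Proof.
under eq_integral do rewrite finE.
rewrite integral_sum//; last first.
  by move=> x; apply: integrableZl => //; exact: integrable_indic.
rewrite -sumEFin; apply: eq_bigr => x _.
rewrite integralZl//; last exact: integrable_indic.
by rewrite integral_indic// setIT EFinM fineK// fin_num_measure.
Qed.

Lemma sum_prob_finite_range : \sum_x fine (Pr [set w | X w = x]) = 1.
Proof.
have := expectation_cst Pr 1; rewrite unlock (integral_finite_range (fun=> 1)) => -[<-].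
by apply: eq_bigr => x _; rewrite mul1r.
Qed.
End FiniteExpectation.

(** * Evolution of the expected gap along the algorithm *)

Section Greedy.
Context {R : realType} {n : nat} {d : measure_display} {Omega : measurableType d}.
Variables (f : {set 'I_n} -> R) (Pr : probability Omega R) (K s : nat).
Variables S D : nat -> Omega -> {set 'I_n}.
Hypothesis greedy : randomized_greedy f Pr K s S D.
Hypothesis marginal_ge0 : forall i (B : {set 'I_n}), 0 <= marginal f i B.

Definition mean_after (i : nat) : R := \sum_B f B * fine (Pr [set w | S i w = B]).

Lemma mean_afterE i : (i <= K)%N -> (\int[Pr]_w (f (S i w))%:E = (mean_after i)%:E)%E.
Proof. by move=> iK; apply: integral_finite_range => B; exact: (rg_measS greedy). Qed.

Lemma mean_after0 : mean_after 0 = f finset.set0.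
Proof.
apply: EFin_inj; rewrite -mean_afterE//.
rewrite -[RHS](expectation_cst Pr) unlock.
by under eq_integral do rewrite (rg_init greedy).
Qed.

(** [rg_draw] conditions on the past samples as well as on the current set; as a finite function the
    past takes finitely many values, so conditioning becomes a finite sum. *)
Definition history (i : nat) (w : Omega) : {ffun 'I_i -> {set 'I_n}} := [ffun j : 'I_i => D j w].

(** Turns a finite history into the [nat]-indexed family expected by [rg_draw]; the default value
    concerns only indices [j >= i], which the event does not constrain. *)
Definition extend (i : nat) (rho : {ffun 'I_i -> {set 'I_n}}) (j : nat) : {set 'I_n} :=
  if insub j is Some j' then rho j' else finset.set0.

Lemma state_historyE i B rho :
  [set w | (S i w, history i w) = (B, rho)] =
  [set w | S i w = B /\ forall j, (j < i)%N -> D j w = extend rho j].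
Proof.
apply/seteqP; split => w /=.
  move=> [<- <-]; split=> // j ji.
  by rewrite /extend insubT ffunE.
move=> [-> E]; congr pair; apply/ffunP => j; rewrite ffunE E//.
by rewrite /extend valK.
Qed.

Lemma measurable_state_history i B rho : (i <= K)%N ->
  measurable [set w | (S i w, history i w) = (B, rho)].
Proof.
move=> iK.
rewrite (_ : [set w | _] = [set w | S i w = B] `&` \bigcap_(j in [set: 'I_i]) [set w | D j w = rho j]).
  apply: measurableI; first exact: (rg_measS greedy).
  apply: fin_bigcap_measurable => // j _; apply: (rg_measD greedy).
  exact: leq_trans (ltn_ord j) iK.
apply/seteqP; split => w /= [].
  by move=> <- <-; split=> // j _ /=; rewrite ffunE.
by move=> <- E; congr pair; apply/ffunP => j; rewrite ffunE E.
Qed.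

Lemma prob_draw i B rho A : (i < K)%N ->
  fine (Pr [set w | (S i w, history i w, D i w) = (B, rho, A)]) =
  draw_prob R s B A * fine (Pr [set w | (S i w, history i w) = (B, rho)]).
Proof.
move=> iK.
rewrite (_ : [set w | _] = [set w | (S i w, history i w) = (B, rho)] `&` [set w | D i w = A]).
  by rewrite state_historyE (rg_draw greedy)// fineM// fin_num_measure// -state_historyE;
    apply: measurable_state_history; exact: ltnW.
by apply/seteqP; split => w /= => [[<- <- <-]//|[[<- <-] <-]].
Qed.

Lemma measurable_draw i B rho A : (i < K)%N ->
  measurable [set w | (S i w, history i w, D i w) = (B, rho, A)].
Proof.
move=> iK.
rewrite (_ : [set w | _] = [set w | (S i w, history i w) = (B, rho)] `&` [set w | D i w = A]).
  apply: measurableI; last exact: (rg_measD greedy).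
  by apply: measurable_state_history; exact: ltnW.
by apply/seteqP; split => w /= => [[<- <- <-]//|[[<- <-] <-]].
Qed.

Definition sample_gain (O B A : {set 'I_n}) : R :=
  (\sum_(j in (A :&: (O :\: B))%SET) marginal f j B) / #|(A :&: (O :\: B))%SET|%:R.

(** The chosen marginal dominates every marginal in the sample, hence any average of them. If the
    draw misses [O :\: B], the average is [0 / 0 = 0] and monotonicity suffices. *)
Lemma step_gain O i w : (i < K)%N ->
  f (S i w) + sample_gain O (S i w) (D i w) <= f (S i.+1 w).
Proof.
move=> iK; have [j [jD jmax ->]] := rg_step greedy w iK.
rewrite -lerBrDl -/(marginal f j (S i w)) /sample_gain.
set A := (_ :&: _)%SET; have [->|A0] := eqVneq A finset.set0.
  by rewrite big_set0 mul0r.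
rewrite ler_pdivrMr ?ltr0n ?lt0n ?cards_eq0// mulr_natr -sumr_const ler_sum//.
by move=> k /finset.setIP[kD _]; exact: jmax.
Qed.

Lemma mean_after_step O (kappa : R) i : (i < K)%N ->
  (forall B, kappa * (f O - f B) <= \sum_A draw_prob R s B A * sample_gain O B A) ->
  f O - mean_after i.+1 <= (1 - kappa) * (f O - mean_after i).
Proof.
move=> iK kgain.
pose p B rho := fine (Pr [set w | (S i w, history i w) = (B, rho)]).
have mSH x : measurable [set w | (S i w, history i w) = x].
  by case: x => B rho; apply: measurable_state_history; exact: ltnW.
have mSHD x : measurable [set w | (S i w, history i w, D i w) = x].
  by case: x => -[B rho] A; exact: measurable_draw.
have mS B : measurable [set w | S i.+1 w = B] by exact: (rg_measS greedy).
have E1 (G : {set 'I_n} -> R) :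
    (\int[Pr]_w (G (S i w))%:E = (\sum_B \sum_rho G B * p B rho)%:E)%E.
  rewrite (integral_finite_range Pr mSH (fun x => G x.1)) pair_big/=.
  by congr EFin; apply: eq_bigr => -[B rho].
(* Given state and history, the sample has law [draw_prob]; its total mass 1 leaves [f B]
   unchanged. *)
have E2 : (\int[Pr]_w (f (S i w) + sample_gain O (S i w) (D i w))%:E =
    (\sum_B \sum_rho (f B + \sum_A draw_prob R s B A * sample_gain O B A) * p B rho)%:E)%E.
  rewrite (integral_finite_range Pr mSHD (fun x => f x.1.1 + sample_gain O x.1.1 x.2)).
  congr EFin; rewrite pair_big/=.
  transitivity (\sum_x \sum_A (f x.1 + sample_gain O x.1 A) *
      fine (Pr [set w | (S i w, history i w, D i w) = (x, A)])).
    by rewrite pair_bigA/=; apply: eq_bigr => -[].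
  apply: eq_bigr => -[B rho] _/=.
  under eq_bigr do rewrite prob_draw// mulrA.
  rewrite -mulr_suml; congr (_ * _).
  under [LHS]eq_bigr do rewrite mulrDl [f B * _]mulrC.
  rewrite big_split/= -[X in X + _ = _]mulr_suml draw_prob_sum1 mul1r; congr (_ + _).
  by apply: eq_bigr => A _; rewrite mulrC.
have : (\int[Pr]_w (f (S i w) + sample_gain O (S i w) (D i w))%:E <= (mean_after i.+1)%:E)%E.
  rewrite -mean_afterE//; apply: le_integral => //.
  - exact: (integrable_finite_range Pr mSHD (fun x => f x.1.1 + sample_gain O x.1.1 x.2)).
  - exact: integrable_finite_range.
  - by move=> w _; rewrite lee_fin step_gain.
rewrite E2 lee_fin => le1.
have : \sum_B \sum_rho (f B + kappa * (f O - f B)) * p B rho <= mean_after i.+1.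
  apply: le_trans le1; apply: ler_sum => B _; apply: ler_sum => rho _.
  by rewrite ler_wpM2r ?fine_ge0// lerD2l.
(* The integrand depends on [S i] only, so passing back through the integral sums out the
   histories. *)
have -> : \sum_B \sum_rho (f B + kappa * (f O - f B)) * p B rho =
    (1 - kappa) * mean_after i + kappa * f O.
  apply: EFin_inj; rewrite -(E1 (fun B => f B + kappa * (f O - f B))).
  rewrite (integral_finite_range Pr _ (fun B => f B + kappa * (f O - f B))); last first.
    by move=> B; apply: (rg_measS greedy); exact: ltnW.
  have := @sum_prob_finite_range _ _ _ Pr _ (S i) (fun B => rg_measS greedy B (ltnW iK)) => p1.
  congr EFin; rewrite /mean_after -[X in _ = _ + X]mulr1 -[X in _ = _ + _ * X]p1.
  rewrite !mulr_sumr -big_split/=.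
  by apply: eq_bigr => B _; ring.
lra.
Qed.

Lemma mean_after_ge O (kappa : R) : kappa <= 1 ->
  (forall B, kappa * (f O - f B) <= \sum_A draw_prob R s B A * sample_gain O B A) ->
  f O - mean_after K <= (1 - kappa) ^+ K * (f O - f finset.set0).
Proof.
move=> k1 kgain; have : (K <= K)%N by [].
elim: {1 3 4}K => [_|i IH iK]; first by rewrite expr0 mul1r mean_after0.
apply: (le_trans (mean_after_step iK kgain)).
(* [kappa <= 1] keeps the factor nonnegative, so the bounds can be chained. *)
by rewrite exprS -mulrA ler_wpM2l ?subr_ge0// IH// ltnW.
Qed.
End Greedy.

(** * Scalar estimates for the contraction over K iterations *)

Lemma contraction_rate_le1 {R : realType} (K : nat) (y c : R) :
  (0 < K)%N -> 0 <= y -> 1 <= c -> (1 - y) / (K%:R * c) <= 1.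
Proof.
move=> K0 y0 c1; have c0 : 0 < c by exact: lt_le_trans c1.
rewrite ler_pdivrMr ?mulr_gt0 ?ltr0n// mul1r (@le_trans _ _ 1)//; first by rewrite gerBl.
by rewrite -[leLHS]mulr1 ler_pM ?ler1n.
Qed.

(** By [1 - x <= expR (- x)] the power is at most [expR (- 1 / c) * expR z] with [z = y / c]. Then
    [expR z - 1 <= z * expR z <= z * expR (1 / c)], where [y <= 1] gives [z <= 1 / c], so the excess
    over [expR (- 1 / c)] is at most [z]. *)
Lemma pow_contraction_le {R : realType} (K : nat) (y c : R) :
  (0 < K)%N -> 0 <= y <= 1 -> 1 <= c ->
  (1 - (1 - y) / (K%:R * c)) ^+ K <= expR (- (1 / c)) + y / c.
Proof.
move=> K0 /andP[y0 y1] c1; have c0 : 0 < c by exact: lt_le_trans c1.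
set kappa := (1 - y) / _.
have kappa1 : kappa <= 1 by exact: contraction_rate_le1.
apply: (@le_trans _ _ (expR (- kappa) ^+ K)).
  by rewrite lerXn2r ?nnegrE ?subr_ge0 ?expR_ge0// expR_ge1Dx.
rewrite -expRM_natl; have -> : K%:R * - kappa = - (1 / c) + y / c.
  by rewrite /kappa; field; rewrite !gt_eqF// ltr0n.
rewrite expRD -lerBlDl -[X in _ - X]mulr1 -mulrBr.
set z := y / c.
have h1 : expR z - 1 <= z * expR z.
  have := expR_ge1Dx (- z); rewrite expRN => h.
  have : (1 - z) * expR z <= 1 by rewrite -ler_pdivlMr ?expR_gt0// div1r.
  by rewrite mulrBl mul1r; lra.
have z0 : 0 <= z by rewrite divr_ge0// ltW.
have h2 : expR z <= expR (1 / c) by rewrite ler_expR ler_pM2r ?invr_gt0.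
apply: (@le_trans _ _ (expR (- (1 / c)) * (z * expR (1 / c)))).
  by rewrite ler_wpM2l ?expR_ge0// (le_trans h1)// ler_wpM2l.
by rewrite mulrCA -expRD addNr expR0 mulr1.
Qed.

(** * From the expected gap to the mean-square error *)

Theorem corollary2p1 (R : realType) (n m K : nat)
    (P : 'M[R]_m) (h : 'I_n -> 'cV[R]_m) (sigma : 'I_n -> R)
    (eps : R) (s : nat)
    (d : measure_display) (Omega : measurableType d)
    (Pr : probability Omega R)
    (S D : nat -> Omega -> {set 'I_n}) (O : {set 'I_n}) :
  (2 <= n)%N -> (1 <= m)%N -> (1 <= K <= n)%N ->
  sym_posdef P ->
  (forall i, 0 < sigma i ^+ 2) ->
  expR (- K%:R) <= eps < 1 ->
  s%:R = n%:R / K%:R * ln (1 / eps) ->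
  let f := sensing_obj P h sigma in
  randomized_greedy f Pr K s S D ->
  is_optimal f K O ->
  let c := Num.max (max_curvature f) 1 in
  let alpha := greedy_alpha n s c eps in
  ('E_Pr[fun w => mse P h sigma (S K w)]
     <= (alpha * mse P h sigma O + (1 - alpha) * \tr P)%:E)%E.
Proof.
move=> n2 m1 /andP[K0 Kn] Ppd sigma0 /andP[epsK eps1] sE f greedy [cardO _].
cbv zeta; set c := Num.max _ 1; set alpha := greedy_alpha _ _ _ _.
have eps0 : 0 < eps by apply: lt_le_trans epsK; exact: expR_gt0.
have KR : 0 < K%:R :> R by rewrite ltr0n.
have nR : 0 < n%:R :> R by rewrite ltr0n (leq_trans _ n2).
(* The lower bound [expR (- K) <= eps] says that [ln (1 / eps) <= K]. *)
have sn : (s <= n)%N.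
  rewrite -(ler_nat R) sE -mulrA ler_piMr ?ler0n// mulrC ler_pdivrMr// div1r mul1r.
  by rewrite lnV ?posrE// lerNl -ler_expR lnK ?posrE.
have marg0 : forall i B, 0 <= marginal f i B by exact: sensing_marginal_ge0.
have margeq0 : forall i (B T : {set 'I_n}), i \notin B -> i \notin T ->
  marginal f i B = 0 -> marginal f i T = 0 by exact: sensing_marginal_eq0.
set y := eps `^ greedy_beta R n s in alpha *.
have beta1 : 1 <= greedy_beta R n s.
  by rewrite /greedy_beta; case: eqP => _ //; rewrite lerDl le_max lexx.
have y01 : 0 <= y <= 1.
  by rewrite powR_ge0 (le_trans (ge1r_powR _ beta1))// ?eps0 ltW.
have [y0 y1] := andP y01.
have c1 : 1 <= c by rewrite le_max lexx orbT.
have c0 : 0 < c by exact: lt_le_trans c1.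
pose kappa := (1 - y) / (K%:R * c).
(* The draw captures a fraction [(1 - y) / K] of the sum of marginals over [O :\: B], and that sum
   is at least the gap divided by [c]. *)
have gain B : kappa * (f O - f B) <= \sum_A draw_prob R s B A * sample_gain f O B A.
  have WB : (O :\: B)%SET \subset (~: B)%SET by rewrite finset.setDE finset.subsetIr.
  have WK : (#|(O :\: B)%SET| <= K)%N by rewrite -cardO subset_leq_card// finset.subsetDl.
  have := draw_average_ge K0 sn eps0 sE WB WK (fun j => marg0 j B).
  apply: le_trans.
  rewrite -/y /kappa invfM mulrA -mulrA ler_wpM2l ?divr_ge0 ?subr_ge0 ?ler0n//.
  by rewrite mulrC ler_pdivrMr// mulrC optimum_gap.
have kappa1 : kappa <= 1 by exact: contraction_rate_le1.
have f0 : f finset.set0 = 0 by exact: sensing_obj0.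
(* Nonnegativity of [f O] allows the bound on the contraction factor to be multiplied by it. *)
have fO0 : 0 <= f O.
  have := setU_marginal_sum marg0 margeq0 (B := finset.set0) (W := O).
  rewrite finset.setC0 finset.subsetT finset.set0U => /(_ isT)/andP[+ _].
  by rewrite f0 subr0.
have := mean_after_ge greedy marg0 kappa1 gain.
rewrite f0 subr0 => main.
have {}main : f O - mean_after f Pr S K <= (1 - alpha) * f O.
  apply: (le_trans main); rewrite ler_wpM2r//.
  have -> : 1 - alpha = expR (- (1 / c)) + y / c by rewrite /alpha /greedy_alpha -/y; ring.
  exact: pow_contraction_le.
have mS B : measurable [set w | S K w = B] by exact: (rg_measS greedy).
rewrite unlock (integral_finite_range Pr mS (mse P h sigma)) lee_fin.
(* Pointwise [mse] is [\tr P] minus [f], and the probabilities sum to 1. *)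
have -> : \sum_B mse P h sigma B * fine (Pr [set w | S K w = B]) = \tr P - mean_after f Pr S K.
  rewrite -[\tr P]mulr1 -(sum_prob_finite_range Pr mS) mulr_sumr -sumrB.
  by apply: eq_bigr => B _; rewrite /f sensing_objE; ring.
have -> : mse P h sigma O = \tr P - f O by rewrite /f sensing_objE; ring.
move: main; lra.
Qed.
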